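(* Consider a radial network with the data and notation defined in the context. Assume that $\overline{p}_i,\overline{q}_i\in\mathbb{R}$ ($i\in\mathcal{N}^+$) are such that $\mathcal{S}_i\subseteq\{s\in\mathbb{C}\mid\mathrm{Re}(s)\le\overline{p}_i,\ \mathrm{Im}(s)\le\overline{q}_i\}$ for all $i\in\mathcal{N}^+$. Write $\hat P_{ij}^+(\overline{p})=\max\{\hat P_{ij}(\overline{p}),0\}$ and $\hat Q_{ij}^+(\overline{q})=\max\{\hat Q_{ij}(\overline{q}),0\}$. Suppose that at least one of the following holds: (i) $\hat P_{ij}(\overline{p})\le0$ and $\hat Q_{ij}(\overline{q})\le0$ for any $(i,j)\in\mathcal{E}$ such that $i\notin\mathcal{L}$. (ii) $r_{ij}/x_{ij}=r_{jk}/x_{jk}$ for any $(i,j),(j,k)\in\mathcal{E}$; and $\underline{v}_i-2r_{ij}\hat P_{ij}^+(\overline{p})-2x_{ij}\hat Q_{ij}^+(\overline{q})>0$ for any $(i,j)\in\mathcal{E}$ such that $i\notin\mathcal{L}$. (iii) $r_{ij}/x_{ij}\ge r_{jk}/x_{jk}$ for any $(i,j),(j,k)\in\mathcal{E}$; and $\hat P_{ij}(\overline{p})\le0$, $\underline{v}_i-2x_{ij}\hat Q_{ij}^+(\overline{q})>0$ for any $(i,j)\in\mathcal{E}$ such that $i\notin\mathcal{L}$. (iv) $r_{ij}/x_{ij}\le r_{jk}/x_{jk}$ for any $(i,j),(j,k)\in\mathcal{E}$; and $\hat Q_{ij}(\overline{q})\le0$, $\underline{v}_i-2r_{ij}\hat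 P_{ij}^+(\overline{p})>0$ for any $(i,j)\in\mathcal{E}$ such that $i\notin\mathcal{L}$. (v) For all $(i,j)\in\mathcal{E}$ (componentwise, empty products being $1$ and empty sums $0$), $$\begin{pmatrix}\prod_{(k,l)\in\mathcal{P}_j}\left(1-\frac{2r_{kl}\hat P_{kl}^+(\overline{p})}{\underline{v}_k}\right) & -\sum_{(k,l)\in\mathcal{P}_j}\frac{2r_{kl}\hat Q_{kl}^+(\overline{q})}{\underline{v}_k} \\ -\sum_{(k,l)\in\mathcal{P}_j}\frac{2x_{kl}\hat P_{kl}^+(\overline{p})}{\underline{v}_k} & \prod_{(k,l)\in\mathcal{P}_j}\left(1-\frac{2x_{kl}\hat Q_{kl}^+(\overline{q})}{\underline{v}_k}\right)\end{pmatrix}\begin{pmatrix} r_{ij} \\ x_{ij} \end{pmatrix}>0.$$ Then condition C1 holds: $\underline{A}_{l_s}\underline{A}_{l_{s+1}}\cdots\underline{A}_{l_{t-1}}u_{l_t}>0$ (componentwise) for every leaf $l\in\mathcal{L}$ and all integers $s,t$ with $1\le s\le t\le n_l$ (for $s=t$ the expression is $u_{l_t}$).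
   Context: Network. Let $n\ge 1$, $\mathcal{N}=\{0,1,\dots,n\}$ (buses), $\mathcal{N}^+=\mathcal{N}\setminus\{0\}$. The network is a tree on $\mathcal{N}$ rooted at bus $0$. Each line is an ordered pair $(i,j)$ of adjacent buses where $j$ lies on the unique path from $i$ to $0$; thus each $i\in\mathcal{N}^+$ has exactly one line $(i,j)$ leaving it. $\mathcal{E}$ is the set of lines, and $i\to j$ means $(i,j)\in\mathcal{E}$. $\mathcal{P}_i$ denotes the path from $i$ to $0$ (the collection of its buses, including $i$ and $0$, and of its lines; $\mathcal{P}_0$ contains no line). Each line $(i,j)$ has resistance $r_{ij}>0$ and reactance $x_{ij}>0$. For $i\in\mathcal{N}^+$, a voltage lower bound $\underline{v}_i>0$ and a set $\mathcal{S}_i\subseteq\mathbb{C}$ are given. For $p,q\in\mathbb{R}^n$ (indexed by $\mathcal{N}^+$) and $(i,j)\in\mathcal{E}$: $\hat P_{ij}(p)=\sum_{h:\,i\in\mathcal{P}_h}p_h$ and $\hat Q_{ij}(q)=\sum_{h:\,i\in\mathcal{P}_h}q_h$. Matrices. With $I$ the $2\times2$ identity, $\overline{p}=(\overline{p}_i)_{i\in\mathcal{N}^+}$, $\overline{q}=(\overline{q}_i)_{i\in\mathcal{N}^+}$, and $(i,j)$ the unique line leaving $i\in\mathcal{N}^+$: $u_i=\begin{pmatrix} r_{ij} \\ x_{ij} \end{pmatrix}$ and $\underline{A}_i=I-\frac{2}{\underline{v}_i}\begin{pmatrix} r_{ij} \\ x_{ij} \end{pmatrix}\begin{pmatrix}\hat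 P_{ij}^+(\overline{p}) & \hat Q_{ij}^+(\overline{q})\end{pmatrix}$. Leaves. $\mathcal{L}=\{l\in\mathcal{N}\mid \nexists k\in\mathcal{N}: k\to l\}$. For $l\in\mathcal{L}$, $n_l+1$ is the number of buses on $\mathcal{P}_l$, and $\mathcal{P}_l$ is written $l_{n_l}\to l_{n_l-1}\to\cdots\to l_1\to l_0$ with $l_{n_l}=l$, $l_0=0$. *)

(* Defs.v *)
From HB Require Import structures.
From mathcomp Require Import all_boot all_order all_algebra.
From mathcomp Require Import classical_sets reals.
From mathcomp.real_closed Require Import complex.
Set Implicit Arguments.
Unset Strict Implicit.
Unset Printing Implicit Defensive.
Import Order.TTheory GRing.Theory Num.Theory.
Local Open Scope ring_scope.

Definition simple_path (V : eqType) (e : rel V) (x y : V) (s : seq V) : bool :=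
  [&& path e x s, last x s == y & uniq (x :: s)].

(* Buses are 'I_n.+1, the root is ord0. *)
Record tree (n : nat) := Tree {
  adj : rel 'I_n.+1;
  adj_sym : symmetric adj;
  adj_irrefl : irreflexive adj;
  adj_unique_path : forall i j, exists! s, simple_path adj i j s }.

Lemma root_path_exists (n : nat) (T : tree n) (i : 'I_n.+1) :
  exists s, simple_path (adj T) i ord0 s.
Proof. by have [s [Hs _]] := adj_unique_path T i ord0; exists s. Qed.

Section Network.
Variables (n : nat) (T : tree n).
Local Notation bus := 'I_n.+1.

(* The buses of the path from i to the root, listed from i to ord0. *)
Definition path_buses (i : bus) : seq bus := i :: xchoose (root_path_exists T i).

Definition path_lines (i : bus) : seq (bus * bus) :=
  zip (path_buses i) (behead (path_buses i)).

Definition line (i j : bus) : bool := adj T i j && (j \in path_buses i).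

(* The j of the unique line (i, j) leaving i; the default is used only at the
   root, which no line leaves. *)
Definition next_bus (i : bus) : bus := odflt ord0 [pick j | line i j].

Definition leaf (l : bus) : bool := ~~ [exists k, line k l].

Definition leaf_depth (l : bus) : nat := (size (path_buses l)).-1.

(* The bus l_k of the path l = l_(n_l) -> ... -> l_1 -> l_0 = 0. *)
Definition path_bus (l : bus) (k : nat) : bus := nth ord0 (rev (path_buses l)) k.

(* Families indexed by the non-root buses are functions on all buses, and
   families indexed by lines are functions of two buses; the values outside the
   intended index sets are never used. *)
Variable R : realType.
Implicit Types (p q v : bus -> R) (r x : bus -> bus -> R).

(* Both \hat P_ij(p) and \hat Q_ij(q). *)
Definition flow p (i j : bus) : R :=
  \sum_(h : bus | (h != ord0) && (i \in path_buses h)) p h.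

Definition flow_pos p (i j : bus) : R := Num.max (flow p i j) 0.

Definition col2 (a b : R) : 'cV[R]_2 := \col_(i < 2) [:: a; b]`_i.

Definition mx2 (a b c d : R) : 'M[R]_2 :=
  \matrix_(i < 2, j < 2) (nth [::] [:: [:: a; b]; [:: c; d]] i)`_j.

Definition col_positive (w : 'cV[R]_2) : Prop := forall i, 0 < w i 0.

Definition u_ r x (i : bus) : 'cV[R]_2 := col2 (r i (next_bus i)) (x i (next_bus i)).

Definition A_ r x v (pbar qbar : bus -> R) (i : bus) : 'M[R]_2 :=
  1%:M - (2 / v i) *:
    (u_ r x i *m (col2 (flow_pos pbar i (next_bus i)) (flow_pos qbar i (next_bus i)))^T).

(* The iterated product is the ordered one of the matrix ring 'M_2. *)
Definition condition_C1 r x v (pbar qbar : bus -> R) : Prop :=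
  forall (l : bus) (s t : nat), leaf l ->
    (1 <= s)%N -> (s <= t)%N -> (t <= leaf_depth l)%N ->
    col_positive ((\prod_(s <= k < t) A_ r x v pbar qbar (path_bus l k))
                    *m u_ r x (path_bus l t)).

End Network.

(* Main.v *)
Require Import Defs.
From mathcomp Require Import all_boot all_order all_algebra.
From mathcomp Require Import classical_sets reals.
From mathcomp.real_closed Require Import complex.
From mathcomp Require Import zify ring lra.
Set Implicit Arguments.
Unset Strict Implicit.
Unset Printing Implicit Defensive.
Import Order.TTheory GRing.Theory Num.Theory.
Local Open Scope ring_scope.

(** Write w -> A_i w for the update performed by one line.  Since
    A_i w = w - g u_i with the scalar g = (2 / v_i) (P_i w_1 + Q_i w_2), where
    P_i, Q_i >= 0 are the positive parts of the flows on the line, each A_i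
    moves a vector along u_i only, and C1 asserts that the vectors obtained
    from u_(l_t) by applying A_(l_(t-1)), ..., A_(l_s) in turn stay positive.
    The product stops before t <= n_l, so every bus that contributes a matrix
    has a child on the path and is not a leaf, so that the conditions imposed
    at non-leaf buses apply to it.  In each case an invariant of w is carried
    from t down to s ([prod_mulmx_ind]).

    (i) Every A_i in the product is the identity.

    (ii) The u_i along the path are parallel, so each is an eigenvector of every
    A_i in the product, with an eigenvalue that the second part of (ii) makes
    positive ([chain_eigen_gt0]).

    (iii) Now g = (2 / v_i) Q_i w_2, so the second component is multiplied by
    1 - 2 x_i Q_i / v_i > 0.  The determinant of (w, u_i) is unchanged by A_i,
    so w_1 / w_2 >= r_i / x_i implies the same for A_i w, whose first component
    is then positive too.  The ratios r / x do not increase towards the root, so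
    this comparison is handed on to the next line.  Condition (iv)
    is the same with the two components exchanged ([chain_ratio_gt0]).

    (v) The components of A_(l_s) ... A_(l_(t-1)) u_(l_t) are bounded below by
    those of the matrix of (v) applied to u_(l_t), with products and sums
    restricted to the buses l_s, ..., l_(t-1).  Comparing the matrices entry by
    entry is not enough for an induction: a diagonal entry of a product of the
    A_i can exceed 1, and it is then multiplied by a negative off-diagonal entry.
    Comparing vectors works: as long as w stays positive, it only decreases, so
    w <= u_(l_t), and this upper bound controls the negative contributions
    ([chain_bound_gt0]).

    The tree enters only through two consequences of the uniqueness of simple
    paths: the path to the root from a bus on P_l is a suffix of P_l
    ([path_buses_nth]), and the line leaving a bus goes to the next bus on its
    path ([line_second]). *)

(** * Paths to the root *)

Section Tree.
Variables (n : nat) (T : tree n).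
Local Notation bus := 'I_n.+1.

Lemma simple_path_unique (i j : bus) (s1 s2 : seq bus) :
  simple_path (adj T) i j s1 -> simple_path (adj T) i j s2 -> s1 = s2.
Proof.
by have [s [_ Us]] := adj_unique_path T i j => /Us <- /Us.
Qed.

Lemma path_buses_simple (i : bus) :
  simple_path (adj T) i ord0 (behead (path_buses T i)).
Proof. exact: (xchooseP (root_path_exists T i)). Qed.

Lemma path_buses_eq (i : bus) (s : seq bus) :
  simple_path (adj T) i ord0 s -> path_buses T i = i :: s.
Proof. by move=> /(simple_path_unique (path_buses_simple i)) <-. Qed.

Lemma simple_path_suffix (i j k : bus) (s1 s2 : seq bus) :
  simple_path (adj T) i j (s1 ++ k :: s2) -> simple_path (adj T) k j s2.
Proof.
rewrite /simple_path cat_path last_cat -cat_cons cat_uniq => /and3P[/andP[_ /=]].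
by move=> /andP[_ ->] -> /and3P[_ _ ->].
Qed.

(** A suffix of a simple path is simple, hence the only simple path from its
    first bus to the root. *)
Lemma path_buses_nth (l : bus) (m : nat) : (m < size (path_buses T l))%N ->
  path_buses T (nth ord0 (path_buses T l) m) = drop m (path_buses T l).
Proof.
move=> lt_m; have Hl := path_buses_simple l.
rewrite [RHS](drop_nth ord0) //; case: m lt_m => [|m] lt_m.
  by rewrite drop1; apply: path_buses_eq.
apply: path_buses_eq.
apply: (simple_path_suffix (i := l) (s1 := take m (behead (path_buses T l)))).
rewrite -[drop m.+2 _]/(drop m.+1 (behead (path_buses T l))).
rewrite -[nth _ _ _]/(nth ord0 (behead (path_buses T l)) m).
by rewrite -drop_nth // cat_take_drop.
Qed.

(** If a neighbour j of i came later on the path from i to the root, then the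
    line (i, j) and the part of the path from i to j would be two simple paths
    from i to j. *)
Lemma line_second (i j : bus) :
  line T i j = (1 < size (path_buses T i))%N && (nth ord0 (path_buses T i) 1 == j).
Proof.
have := path_buses_simple i; rewrite /line /path_buses /= => Hi.
apply/idP/idP => [/andP[adj_ij]|].
  have neq_ij : i != j by apply: contraTneq adj_ij => ->; rewrite adj_irrefl.
  rewrite inE eq_sym (negPf neq_ij) /= => /splitPr jin.
  case: jin Hi => p1 p2 /= Hi.
  suff : rcons p1 j = [:: j] by case: p1 {Hi} => [|y [|]] //= _; rewrite eqxx.
  apply: (@simple_path_unique i j).
    move: Hi; rewrite /simple_path -cat_rcons cat_path -cat_cons cat_uniq.
    by move=> /and3P[/andP[-> _] _ /andP[-> _]]; rewrite last_rcons eqxx.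
  by rewrite /simple_path /= adj_ij eqxx inE neq_ij.
case: (xchoose _) Hi => [//|k s] /and3P[/= /andP[aik _] _ _] /eqP <-.
by rewrite aik !inE eqxx orbT.
Qed.

Lemma next_busE (i j : bus) : line T i j -> next_bus T i = j.
Proof.
move=> lij; rewrite /next_bus; case: pickP => [k|/(_ j)]; last by rewrite lij.
by move: lij; rewrite !line_second => /andP[_ /eqP <-] /andP[_ /eqP <-].
Qed.

Lemma size_path_buses (l : bus) : size (path_buses T l) = (leaf_depth T l).+1.
Proof. by []. Qed.

Lemma path_bus_nth (l : bus) (k : nat) : (k <= leaf_depth T l)%N ->
  path_bus T l k = nth ord0 (path_buses T l) (leaf_depth T l - k).
Proof. by move=> le_k; rewrite /path_bus nth_rev ?size_path_buses // subSS. Qed.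

Lemma path_buses_path_bus (l : bus) (k : nat) : (k <= leaf_depth T l)%N ->
  path_buses T (path_bus T l k) = drop (leaf_depth T l - k) (path_buses T l).
Proof.
by move=> le_k; rewrite path_bus_nth // path_buses_nth // size_path_buses ltnS leq_subr.
Qed.

Lemma path_buses_path_busS (l : bus) (k : nat) : (k < leaf_depth T l)%N ->
  path_buses T (path_bus T l k.+1) =
    path_bus T l k.+1 :: path_buses T (path_bus T l k).
Proof.
move=> lt_k; rewrite !path_buses_path_bus ?(ltnW lt_k) // (drop_nth ord0); last first.
  by rewrite size_path_buses ltnS leq_subr.
by rewrite -path_bus_nth // -subSn // subSS.
Qed.

Lemma line_path_bus (l : bus) (k : nat) : (k < leaf_depth T l)%N ->
  line T (path_bus T l k.+1) (path_bus T l k).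
Proof. by move=> lt_k; rewrite line_second path_buses_path_busS //= eqxx. Qed.

Lemma path_bus_neq0 (l : bus) (k : nat) : (k < leaf_depth T l)%N ->
  path_bus T l k.+1 != ord0.
Proof.
move=> lt_k; have := path_buses_simple (path_bus T l k.+1).
rewrite path_buses_path_busS //= => /and3P[_ /eqP last0 /andP[+ _]].
by apply: contraNneq => ->; rewrite -[X in X \in _]last0 /= mem_last.
Qed.

Lemma path_bus_not_leaf (l : bus) (k : nat) : (k < leaf_depth T l)%N ->
  ~~ leaf T (path_bus T l k).
Proof.
move=> lt_k; rewrite negbK; apply/existsP; exists (path_bus T l k.+1).
exact: line_path_bus.
Qed.

(** Brings the products and sums of condition (v) to the numbering of the buses
    from the root that the product in C1 uses. *)
Lemma big_path_lines (V : Type) (idx : V) (op : Monoid.com_law idx)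
    (F : bus * bus -> V) (l : bus) (m : nat) : (m <= leaf_depth T l)%N ->
  \big[op/idx]_(e <- path_lines T (path_bus T l m)) F e =
  \big[op/idx]_(1 <= h < m.+1) F (path_bus T l h, path_bus T l h.-1).
Proof.
elim: m => [_|m IHm lt_m].
  rewrite big_geq // /path_lines path_buses_path_bus // subn0.
  rewrite (drop_nth ord0) ?size_path_buses //.
  by rewrite drop_oversize ?size_path_buses //= big_nil.
rewrite big_nat_recr //= Monoid.mulmC -IHm ?(ltnW lt_m) //.
by rewrite {1}/path_lines path_buses_path_busS // [zip _ _]/= big_cons.
Qed.

End Tree.

(** * Products of rank-one perturbations of the identity *)

Lemma forall_I2 (P : 'I_2 -> Prop) : P 0 -> P 1 -> forall i, P i.
Proof.
by move=> P0 P1 [[|[|//]] lt_i]; [move: P0 | move: P1]; congr P; apply: val_inj.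
Qed.

Lemma col_positiveP (R : realType) (w : 'cV[R]_2) :
  col_positive w <-> 0 < w 0 0 /\ 0 < w 1 0.
Proof.
by split=> [w_gt0|[w0 w1]]; [split; apply: w_gt0 | apply: forall_I2].
Qed.

Section Chain.
Variable R : realType.

(** The form of A_i: u is u_i, and f collects the two flows times 2 / v_i. *)
Definition line_mx (u f : 'cV[R]_2) : 'M[R]_2 := 1%:M - u *m f^T.

Lemma line_mx_mul (u f w : 'cV[R]_2) (m : 'I_2) :
  (line_mx u f *m w) m 0 = w m 0 - (f^T *m w) 0 0 * u m 0.
Proof.
rewrite /line_mx mulmxBl mul1mx -mulmxA [f^T *m w]mx11_scalar mul_mx_scalar.
by rewrite !mxE /= mulr1n.
Qed.

(** Stated around either index m, with rev_ord m the other one, so that the two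
    components are treated by a single argument. *)
Lemma dotmx2 (f w : 'cV[R]_2) (m : 'I_2) :
  (f^T *m w) 0 0 = f m 0 * w m 0 + f (rev_ord m) 0 * w (rev_ord m) 0.
Proof.
rewrite mxE big_ord_recl big_ord1 !mxE.
case: m => [[|[|//]] lt_m]; last rewrite addrC.
all: by congr (f _ _ * w _ _ + f _ _ * w _ _); apply: val_inj.
Qed.

(** An ordered product of matrices acts from its rightmost factor, so a property
    of the vector is carried from t down to s. *)
Lemma prod_mulmx_ind (K : nat -> 'cV[R]_2 -> Prop) (A : nat -> 'M[R]_2)
    (u : 'cV[R]_2) (s0 t : nat) :
  K t u ->
  (forall k w, (s0 <= k < t)%N -> K k.+1 w -> K k (A k *m w)) ->
  forall s, (s0 <= s <= t)%N -> K s ((\prod_(s <= k < t) A k) *m u).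
Proof.
move=> Kt Kstep s /andP[le_s0 le_st]; rewrite -(subKn le_st).
have: (t - s <= t - s0)%N by rewrite leq_sub2l.
elim: (t - s)%N (leq_subr s t) => [|d IHd] lt_d le_d.
  by rewrite subn0 big_geq // mul1mx.
have lt_t : (t - d.+1 < t)%N by lia.
rewrite big_ltn // -mulmxE -mulmxA; apply: Kstep; first by lia.
rewrite -subSn // subSS; apply: IHd; lia.
Qed.

Variables (u f : nat -> 'cV[R]_2) (t : nat).
Hypothesis u_gt0 : forall k, (1 <= k <= t)%N -> col_positive (u k).

(** If all u k are parallel, then u k is an eigenvector of each line_mx, with
    eigenvalue 1 minus the scalar product of f k and u k. *)
Lemma chain_eigen_gt0 :
  (forall k, (1 <= k < t)%N -> exists a, u k.+1 = a *: u k) ->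
  (forall k, (1 <= k < t)%N -> 0 < 1 - ((f k)^T *m u k) 0 0) ->
  forall s, (1 <= s <= t)%N ->
    col_positive ((\prod_(s <= k < t) line_mx (u k) (f k)) *m u t).
Proof.
move=> u_par ev_gt0 s s_bnd.
have [b b_gt0 ->] : exists2 b, 0 < b &
    (\prod_(s <= k < t) line_mx (u k) (f k)) *m u t = b *: u s.
  apply: (@prod_mulmx_ind (fun k w => exists2 b, 0 < b & w = b *: u k) _ _ 1) => //.
    by exists 1; rewrite ?scale1r.
  move=> k _ k_bnd [b b_gt0 ->]; have [a Ha] := u_par k k_bnd.
  have a_gt0 : 0 < a.
    have := u_gt0 (k := k.+1) ltac:(lia) 0.
    by rewrite Ha mxE pmulr_lgt0 //; apply: u_gt0; lia.
  exists (b * a * (1 - ((f k)^T *m u k) 0 0)); first by rewrite !mulr_gt0 ?ev_gt0.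
  apply/colP => m; rewrite line_mx_mul Ha scalerA -scalemxAr !mxE.
  ring.
by move=> m; rewrite mxE mulr_gt0 // u_gt0.
Qed.

(** Subtracting a multiple of (r, x) from (a, b) leaves a * x - b * r unchanged,
    hence also the order of the two ratios while the denominators are positive. *)
Lemma ratio_le_shift (r x a b g : R) : 0 < x -> 0 < b -> 0 < b - g * x ->
  r / x <= a / b -> r / x <= (a - g * r) / (b - g * x).
Proof.
move=> x_gt0 b_gt0 b'_gt0; rewrite !ler_pdivrMr // ![_ / _ * _]mulrAC.
by rewrite !ler_pdivlMr // => le_rb; nra.
Qed.

(** The flow in component m vanishes, so the other component is only rescaled by
    1 - f k m' * u k m'.  The invariant is that the ratio of the vector is at
    least that of the next u k; it makes component m positive as well. *)
Lemma chain_ratio_gt0 (m : 'I_2) :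
  let m' := rev_ord m in
  (forall k, (1 <= k < t)%N -> u k m 0 / u k m' 0 <= u k.+1 m 0 / u k.+1 m' 0) ->
  (forall k, (1 <= k < t)%N -> f k m 0 = 0) ->
  (forall k, (1 <= k < t)%N -> 0 < 1 - f k m' 0 * u k m' 0) ->
  forall s, (1 <= s <= t)%N ->
    col_positive ((\prod_(s <= k < t) line_mx (u k) (f k)) *m u t).
Proof.
move=> m' ratio fm0 dm'_gt0 s s_bnd.
have [wm' ratio_w] : let w := (\prod_(s <= k < t) line_mx (u k) (f k)) *m u t in
    0 < w m' 0 /\ u s m 0 / u s m' 0 <= w m 0 / w m' 0.
  apply: (@prod_mulmx_ind
    (fun k w => 0 < w m' 0 /\ u k m 0 / u k m' 0 <= w m 0 / w m' 0) _ _ 1) => //.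
    by split=> //; apply: u_gt0; lia.
  move=> k w k_bnd [wm' ratio_w].
  rewrite !line_mx_mul (dotmx2 _ _ m) fm0 // mul0r add0r.
  have wm'_new : 0 < w m' 0 - f k m' 0 * w m' 0 * u k m' 0.
    by rewrite -[X in X - _]mulr1 [f k m' 0 * _]mulrC -mulrA -mulrBr mulr_gt0 ?dm'_gt0.
  split=> //; apply: ratio_le_shift => //; first by apply: u_gt0; lia.
  by apply: le_trans (ratio k k_bnd) ratio_w.
have wm : 0 < ((\prod_(s <= k < t) line_mx (u k) (f k)) *m u t) m 0.
  have := lt_le_trans (divr_gt0 (u_gt0 s_bnd m) (u_gt0 s_bnd m')) ratio_w.
  by rewrite pmulr_lgt0 ?invr_gt0.
move=> i; have [->//|neq_im] := eqVneq i m.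
suff -> : i = m' by [].
apply: val_inj; move: neq_im; rewrite -val_eqE /=.
by case: (i) (m) => [[|[|//]] ?] [[|[|//]] ?].
Qed.

(** Component m of the matrix of condition (v) applied to u h, restricted to the
    lines s, ..., h - 1 of the path. *)
Definition cross_bound (m : 'I_2) (s h : nat) : R :=
  (\prod_(s <= k < h) (1 - f k m 0 * u k m 0)) * u h m 0
  - (\sum_(s <= k < h) f k (rev_ord m) 0 * u k m 0) * u h (rev_ord m) 0.

(** The hypothesis for h = 1, ..., t forces all prefix products of the diagonal
    factors to be positive, hence each factor lies in ]0, 1]; so the bound only
    increases when the lines below s are dropped.  The invariant is then
    cross_bound m k t <= w m <= u t m. *)
Lemma chain_bound_gt0 :
  (forall k m, (1 <= k < t)%N -> 0 <= f k m 0) ->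
  (forall h m, (1 <= h <= t)%N -> 0 < cross_bound m 1 h) ->
  forall s, (1 <= s <= t)%N ->
    col_positive ((\prod_(s <= k < t) line_mx (u k) (f k)) *m u t).
Proof.
move=> f_ge0 bound_gt0.
pose alpha m k := 1 - f k m 0 * u k m 0.
pose beta m k := f k (rev_ord m) 0 * u k m 0.
have boundE m s h : cross_bound m s h = (\prod_(s <= k < h) alpha m k) * u h m 0
  - (\sum_(s <= k < h) beta m k) * u h (rev_ord m) 0 by [].
have beta_ge0 m k : (1 <= k < t)%N -> 0 <= beta m k.
  by move=> k_bnd; rewrite mulr_ge0 ?f_ge0 // ltW // u_gt0 //; lia.
have sum_ge0 m s h : (1 <= s)%N -> (h <= t)%N -> 0 <= \sum_(s <= k < h) beta m k.
  by move=> s1 ht; rewrite big_nat sumr_ge0 // => k /andP[? ?]; apply: beta_ge0; lia.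
(* In bound_gt0 the subtracted sum is nonnegative. *)
have prod_gt0 m h : (1 <= h <= t)%N -> 0 < \prod_(1 <= k < h) alpha m k.
  move=> h_bnd; have := bound_gt0 h m h_bnd; rewrite boundE subr_gt0 => /(le_lt_trans _).
  rewrite -(pmulr_lgt0 _ (u_gt0 h_bnd m)); apply; rewrite mulr_ge0 ?sum_ge0 //.
    by lia.
  by rewrite ltW // u_gt0.
(* Each factor is a quotient of two consecutive prefix products. *)
have alpha_gt0 m k : (1 <= k < t)%N -> 0 < alpha m k.
  move=> k_bnd; have := prod_gt0 m k.+1 ltac:(lia).
  by rewrite big_nat_recr /=; [rewrite pmulr_rgt0 ?prod_gt0 //; lia | lia].
have alpha_le1 m k : (1 <= k < t)%N -> alpha m k <= 1.
  by move=> k_bnd; rewrite gerBl mulr_ge0 ?f_ge0 // ltW // u_gt0 //; lia.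
have bound_s_gt0 m s : (1 <= s <= t)%N -> 0 < cross_bound m s t.
  move=> /andP[s1 st]; have t1 : (1 <= t <= t)%N by lia.
  apply: lt_le_trans (bound_gt0 t m t1) _.
  rewrite !boundE !(big_cat_nat s1 st) /= lerB // ler_wpM2r ?(ltW (u_gt0 t1 _)) //.
    rewrite ger_pMl.
      rewrite big_nat; apply: prodr_ile1 => k k_bnd.
      by rewrite ?alpha_le1 ?(ltW (alpha_gt0 _ _ _)) //; lia.
    by rewrite big_nat prodr_gt0 // => k k_bnd; apply: alpha_gt0; lia.
  by rewrite lerDr sum_ge0.
move=> s s_bnd.
pose K k (w : 'cV[R]_2) := (1 <= k)%N /\ forall m, cross_bound m k t <= w m 0 <= u t m 0.
suff [_ Ks] : K s ((\prod_(s <= k < t) line_mx (u k) (f k)) *m u t).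
  by move=> m; have /andP[+ _] := Ks m; apply: lt_le_trans; apply: bound_s_gt0.
apply: (@prod_mulmx_ind K _ _ 1) => //.
  split=> [|m]; first by lia.
  by rewrite boundE !big_geq // mul1r mul0r subr0 lexx.
move=> k w k_bnd [_ Kw]; split=> [|m]; first by lia.
have w_gt0 j : 0 < w j 0.
  have /andP[+ _] := Kw j; apply: lt_le_trans; apply: bound_s_gt0; lia.
rewrite line_mx_mul (dotmx2 _ _ m).
have /andP[lo up] := Kw m; have /andP[_ up'] := Kw (rev_ord m).
have fm := f_ge0 k m k_bnd; have fm' := f_ge0 k (rev_ord m) k_bnd.
have um : 0 < u k m 0 by apply: u_gt0; lia.
apply/andP; split; last first.
  apply: le_trans up; rewrite gerBl mulr_ge0 ?(ltW um) //.
  by rewrite addr_ge0 // mulr_ge0 // ltW.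
have -> : w m 0 - (f k m 0 * w m 0 + f k (rev_ord m) 0 * w (rev_ord m) 0) * u k m 0
    = alpha m k * w m 0 - beta m k * w (rev_ord m) 0 by rewrite /alpha /beta; ring.
have lt_kt : (k < t)%N by lia.
rewrite !boundE !(big_ltn lt_kt).
have a_gt0 := alpha_gt0 m k k_bnd; have a_le1 := alpha_le1 m k k_bnd.
have b_ge0 := beta_ge0 m k k_bnd.
have ut : 0 < u t (rev_ord m) 0 by apply: u_gt0; lia.
have S_ge0 : 0 <= \sum_(k.+1 <= j < t) beta m j by apply: sum_ge0.
(* alpha * w m >= alpha * (bound for k + 1), where alpha <= 1 leaves the
   subtracted sum at most as large, and w (rev_ord m) <= u t (rev_ord m). *)
have H1 := ler_wpM2l (ltW a_gt0) lo.
have H2 := ler_wpM2l b_ge0 up'.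
have H3 : alpha m k * ((\sum_(k.+1 <= j < t) beta m j) * u t (rev_ord m) 0) <=
    (\sum_(k.+1 <= j < t) beta m j) * u t (rev_ord m) 0.
  by rewrite ler_piMl // mulr_ge0 // ltW.
move: H1 H2 H3; rewrite !boundE; lra.
Qed.

End Chain.

(** * The network *)

Lemma A_line_mx (R : realType) (n : nat) (T : tree n) (r x : 'I_n.+1 -> 'I_n.+1 -> R)
    (v pbar qbar : 'I_n.+1 -> R) (i : 'I_n.+1) :
  A_ T r x v pbar qbar i = line_mx (u_ T r x i)
    ((2 / v i) *: col2 (flow_pos T pbar i (next_bus T i))
                       (flow_pos T qbar i (next_bus T i))).
Proof. by rewrite /A_ /line_mx scalemxAr; congr (_ - _ *m _); rewrite linearZ. Qed.

Theorem theorem4 (R : realType) (n : nat) (n_ge1 : (1 <= n)%N) (T : tree n)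
  (r x : 'I_n.+1 -> 'I_n.+1 -> R)
  (r_gt0 : forall i j, line T i j -> 0 < r i j)
  (x_gt0 : forall i j, line T i j -> 0 < x i j)
  (v : 'I_n.+1 -> R) (v_gt0 : forall i, i != ord0 -> 0 < v i)
  (S : 'I_n.+1 -> set R[i])
  (pbar qbar : 'I_n.+1 -> R)
  (S_bounded : forall i, i != ord0 ->
     (S i `<=` [set s | complex.Re s <= pbar i /\ complex.Im s <= qbar i])%classic) :
  (   (* (i) *)
      forall i j, line T i j -> ~~ leaf T i ->
        flow T pbar i j <= 0 /\ flow T qbar i j <= 0
    ) \/ ( (* (ii) *)
      (forall i j k, line T i j -> line T j k -> r i j / x i j = r j k / x j k) /\
      (forall i j, line T i j -> ~~ leaf T i ->
        0 < v i - 2 * r i j * flow_pos T pbar i j - 2 * x i j * flow_pos T qbar i j)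
    ) \/ ( (* (iii) *)
      (forall i j k, line T i j -> line T j k -> r j k / x j k <= r i j / x i j) /\
      (forall i j, line T i j -> ~~ leaf T i ->
        flow T pbar i j <= 0 /\ 0 < v i - 2 * x i j * flow_pos T qbar i j)
    ) \/ ( (* (iv) *)
      (forall i j k, line T i j -> line T j k -> r i j / x i j <= r j k / x j k) /\
      (forall i j, line T i j -> ~~ leaf T i ->
        flow T qbar i j <= 0 /\ 0 < v i - 2 * r i j * flow_pos T pbar i j)
    ) \/ ( (* (v) *)
      forall i j, line T i j ->
        col_positive
          (mx2 (\prod_(e <- path_lines T j)
                  (1 - 2 * r e.1 e.2 * flow_pos T pbar e.1 e.2 / v e.1))
               (- \sum_(e <- path_lines T j)
                  2 * r e.1 e.2 * flow_pos T qbar e.1 e.2 / v e.1)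
               (- \sum_(e <- path_lines T j)
                  2 * x e.1 e.2 * flow_pos T pbar e.1 e.2 / v e.1)
               (\prod_(e <- path_lines T j)
                  (1 - 2 * x e.1 e.2 * flow_pos T qbar e.1 e.2 / v e.1))
             *m col2 (r i j) (x i j))
  ) ->
  condition_C1 T r x v pbar qbar.
Proof.
move=> conds l s t _ s1 st t_le.
under eq_big_nat do rewrite A_line_mx.
pose b := path_bus T l.
pose u k := u_ T r x (b k).
pose f k := (2 / v (b k)) *: col2 (flow_pos T pbar (b k) (next_bus T (b k)))
  (flow_pos T qbar (b k) (next_bus T (b k))).
change (col_positive ((\prod_(s <= k < t) line_mx (u k) (f k)) *m u t)).
have lineb k : (1 <= k <= t)%N -> line T (b k) (b k.-1).
  by case: k => // k k_bnd; apply: line_path_bus; lia.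
have nextb k : (1 <= k <= t)%N -> next_bus T (b k) = b k.-1.
  by move=> k_bnd; apply: next_busE; apply: lineb.
have leafb k : (1 <= k < t)%N -> ~~ leaf T (b k).
  by move=> k_bnd; apply: path_bus_not_leaf; lia.
have vb k : (1 <= k <= t)%N -> 0 < v (b k).
  by case: k => // k k_bnd; apply/v_gt0/path_bus_neq0; lia.
have u0 k : (1 <= k <= t)%N -> u k 0 0 = r (b k) (b k.-1).
  by move=> k_bnd; rewrite mxE /= nextb.
have u1 k : (1 <= k <= t)%N -> u k 1 0 = x (b k) (b k.-1).
  by move=> k_bnd; rewrite mxE /= nextb.
have f0 k : (1 <= k <= t)%N -> f k 0 0 = 2 / v (b k) * flow_pos T pbar (b k) (b k.-1).
  by move=> k_bnd; rewrite !mxE /= nextb.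
have f1 k : (1 <= k <= t)%N -> f k 1 0 = 2 / v (b k) * flow_pos T qbar (b k) (b k.-1).
  by move=> k_bnd; rewrite !mxE /= nextb.
have rev0 : rev_ord 0 = 1 :> 'I_2 by apply: val_inj.
have rev1 : rev_ord 1 = 0 :> 'I_2 by apply: val_inj.
have u_gt0 k : (1 <= k <= t)%N -> col_positive (u k).
  by move=> k_bnd; apply/col_positiveP; rewrite u0 // u1 // r_gt0 ?x_gt0 ?lineb.
have s_bnd : (1 <= s <= t)%N by rewrite s1.
clearbody u f.
have flow_pos0 p i j : flow T p i j <= 0 -> flow_pos T p i j = 0.
  by move=> ?; apply/max_idPr.
have bndW k : (1 <= k < t)%N -> (1 <= k <= t)%N by lia.
have bndS k : (1 <= k < t)%N -> (1 <= k.+1 <= t)%N by lia.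
case: conds => [cond|[[ratio cond]|[[ratio cond]|[[ratio cond]|cond]]]].
- rewrite big_nat big1 ?mul1mx => [|k k_bnd]; first by apply: u_gt0; lia.
  have k_bnd' : (1 <= k < t)%N by lia.
  have [p0 q0] := cond _ _ (lineb k (bndW k k_bnd')) (leafb k k_bnd').
  suff -> : f k = 0 by rewrite /line_mx trmx0 mulmx0 subr0.
  apply/colP; apply: forall_I2; rewrite [RHS]mxE.
    by rewrite f0 ?bndW // flow_pos0 ?mulr0.
  by rewrite f1 ?bndW // flow_pos0 ?mulr0.
- apply: chain_eigen_gt0 => // k k_bnd; have [kW kS] := (bndW k k_bnd, bndS k k_bnd).
    have xk := x_gt0 _ _ (lineb k kW); have xk' := x_gt0 _ _ (lineb _ kS).
    (* The second components fix the factor; the first ones then agree because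
       the ratios r / x do. *)
    exists (x (b k.+1) (b k) / x (b k) (b k.-1)).
    apply/colP; apply: forall_I2; rewrite [RHS]mxE; last first.
      by rewrite !u1 //= divfK ?gt_eqF.
    rewrite !u0 //=; have := ratio _ _ _ (lineb _ kS) (lineb k kW).
    move=> /= /(congr1 ( *%R (x (b k.+1) (b k)))).
    by rewrite mulrC divfK ?gt_eqF // => ->; rewrite mulrAC mulrA.
  have := cond _ _ (lineb k kW) (leafb k k_bnd); have vk := vb k kW.
  rewrite (dotmx2 _ _ 0) rev0 f0 // f1 // u0 // u1 // => cond_k.
  rewrite -(pmulr_rgt0 _ vk); congr (0 < _): cond_k.
  by field; rewrite gt_eqF.
- apply: (chain_ratio_gt0 u_gt0 (m := 0)) s_bnd => k k_bnd;
    have [kW kS] := (bndW k k_bnd, bndS k k_bnd);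
    have [p0 cond_k] := cond _ _ (lineb k kW) (leafb k k_bnd); rewrite ?rev0.
  + rewrite (u0 k) // (u0 k.+1) // (u1 k) // (u1 k.+1) //.
    exact: (ratio _ _ _ (lineb _ kS) (lineb k kW)).
  + by rewrite f0 // flow_pos0 // mulr0.
  + rewrite f1 // u1 //; have vk := vb k kW.
    rewrite -(pmulr_rgt0 _ vk); congr (0 < _): cond_k.
    by field; rewrite gt_eqF.
- apply: (chain_ratio_gt0 u_gt0 (m := 1)) s_bnd => k k_bnd;
    have [kW kS] := (bndW k k_bnd, bndS k k_bnd);
    have [q0 cond_k] := cond _ _ (lineb k kW) (leafb k k_bnd); rewrite ?rev1.
  + rewrite (u0 k) // (u0 k.+1) // (u1 k) // (u1 k.+1) //.
    rewrite -[leLHS]invf_div -[leRHS]invf_div lef_pV2.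
    * exact: (ratio _ _ _ (lineb _ kS) (lineb k kW)).
    * by rewrite posrE divr_gt0 ?r_gt0 ?x_gt0 ?lineb.
    * by rewrite posrE divr_gt0 ?r_gt0 ?x_gt0 //; apply: (lineb _ kS).
  + by rewrite f1 // flow_pos0 // mulr0.
  + rewrite f0 // u0 //; have vk := vb k kW.
    rewrite -(pmulr_rgt0 _ vk); congr (0 < _): cond_k.
    by field; rewrite gt_eqF.
- apply: chain_bound_gt0 => //.
    move=> k m k_bnd; have kW := bndW k k_bnd; move: m; apply: forall_I2;
      rewrite ?f0 ?f1 // mulr_ge0 ?le_max ?lexx ?orbT //.
    + by rewrite divr_ge0 // ltW // vb.
    + by rewrite divr_ge0 // ltW // vb.
  case=> // h m h_bnd.
  have := cond _ _ (lineb _ h_bnd); have h_le : (h <= leaf_depth T l)%N by lia.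
  rewrite /= !(big_path_lines _ _ h_le) => /col_positiveP[].
  rewrite !mxE !big_ord_recl !big_ord0 !mxE /= !addr0 !mulNr => cond0 cond1.
  move: m; apply: forall_I2; rewrite /cross_bound ?rev0 ?rev1 u0 // u1 //.
    congr (0 < _): cond0; congr (_ * _ - _ * _); apply: eq_big_nat => k k_bnd.
      rewrite f0 ?u0; [ring | lia | lia].
    rewrite f1 ?u0; [ring | lia | lia].
  congr (0 < _): cond1; rewrite addrC; congr (_ * _ - _ * _);
    apply: eq_big_nat => k k_bnd.
    rewrite f1 ?u1; [ring | lia | lia].
  rewrite f0 ?u1; [ring | lia | lia].
Qed.
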